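(* Let $n$ be a positive integer and let $P\le\mathrm{Sym}(n)$. Let $t$ denote the number of orbits of $P$ on $\{1,\ldots,n\}$ and let $r$ denote the rank of $P$. Then: (1) For every $0<\epsilon<1$, the probability that a uniformly random element $\sigma\in P$ satisfies $\mathrm{supp}(\sigma)>(1-\epsilon)n$ is at least $1-\frac{t}{\epsilon n}$. Thus, for fixed $\epsilon$, this probability tends to $1$ when $t=o(n)$ (along any sequence of such groups). (2) For every $0<\epsilon<1$, the probability that a uniformly random element $\sigma\in P$ satisfies $\mathrm{supp}(\sigma)>(1-\epsilon)n-t$ is at least $1-\frac{r-t^2}{\epsilon^2n^2}$. Thus, for fixed $\epsilon$, this probability tends to $1$ when $r-t^2=o(n^2)$ (along any sequence of such groups).
   Context: $\mathrm{Sym}(n)$ is the symmetric group on $\{1,\ldots,n\}$. For $\sigma\in\mathrm{Sym}(n)$, $\mathrm{supp}(\sigma)$ is the number of points moved by $\sigma$. The rank of $P\le\mathrm{Sym}(n)$ (not assumed transitive) is the number of orbits of $P$ on ordered pairs of points, i.e. on $\{1,\ldots,n\}^2$ with the componentwise action. *)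

(* Defs.v *)
From HB Require Import structures.
From mathcomp Require Import all_boot all_order all_algebra all_fingroup all_solvable.
From mathcomp Require Import all_classical all_reals all_analysis.
Set Implicit Arguments.
Unset Strict Implicit.
Unset Printing Implicit Defensive.
Import Order.TTheory GRing.Theory Num.Theory numFieldNormedType.Exports.

Definition psupp (n : nat) (s : 'S_n) : nat := #|[set i | s i != i]|.

Definition num_orbits (n : nat) (P : {group 'S_n}) : nat :=
  #|orbit 'P P @: [set: 'I_n]|.

(* Ordered pairs are 2-tuples, with the componentwise action ['P * 2]; the
   diagonal pairs are included. *)
Definition perm_rank (n : nat) (P : {group 'S_n}) : nat :=
  #|orbit ('P * 2) P @: [set: 2.-tuple 'I_n]|.

Definition unif_prob (R : realType) (gT : finGroupType) (P : {group gT})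
    (E : pred gT) : R :=
  (#|[set s in P | E s]|%:R / #|P|%:R)%R.

(* Main.v *)
Require Import Defs.
From HB Require Import structures.
From mathcomp Require Import all_boot all_order all_algebra all_fingroup all_solvable.
From mathcomp Require Import all_classical all_reals all_analysis.
From mathcomp Require Import ring lra.
Set Implicit Arguments.
Unset Strict Implicit.
Unset Printing Implicit Defensive.
Import Order.TTheory GRing.Theory Num.Theory numFieldNormedType.Exports.

(** The number f of fixed points of a permutation is n minus its support, and f ^ 2
    is its number of fixed points on ordered pairs.  By orbit counting (Cauchy and
    Frobenius), over P the mean of f is t and its second moment is r, so that its
    variance is r - t ^ 2.  Markov's inequality for f gives (1), and Chebyshev's
    inequality gives (2). *)
Local Open Scope ring_scope.

Lemma psupp_fix (n : nat) (s : 'S_n) : (psupp s + #|('Fix_'P[s])%g|)%N = n.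
Proof.
rewrite -[RHS](card_ord n) -(cardsC [set i | s i != i]); congr (_ + _)%N.
apply: eq_card => i; rewrite finset.in_setC finset.in_set negbK.
by apply/afix1P/eqP.
Qed.

(** A pair is fixed componentwise exactly when both entries are fixed. This is what turns the second
    moment of the fixed-point count into an orbit count on pairs. *)
Lemma card_fix_pairs (gT : finGroupType) (T : finType)
    (to : {action gT &-> T}) (a : gT) :
  #|afix (to * 2) [set a]| = (#|('Fix_to[a])%g| ^ 2)%N.
Proof.
rewrite -mulnn -cardsX.
(* The injection [u |-> [tuple u.1; u.2]] carries the product of fixed-point sets to 2-tuples, the
   points of [to * 2]. *)
rewrite -(card_imset _ (f := fun u : T * T => [tuple u.1; u.2])); last first.
  by move=> [x y] [x' y'] [-> ->].
apply: eq_card => w; apply/afix1P/imsetP => [|[[x y]]].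
  case: (tupleP w) => x w1; case: (tupleP w1) => y w2.
  rewrite (tuple0 w2) => -[tox toy].
  exists (x, y); last exact: val_inj.
  by rewrite finset.in_setX; apply/andP; split; apply/afix1P.
rewrite finset.in_setX => /andP[/afix1P /= tox /afix1P /= toy ->].
by apply: val_inj; rewrite /= tox toy.
Qed.

(** Orbit counting for an arbitrary action, so that it applies both to points (first moment) and to
    pairs (second moment). *)
Lemma sum_fix (gT : finGroupType) (T : finType) (to : {action gT &-> T})
    (G : {group gT}) :
  (\sum_(a in G) #|('Fix_to[a])%g|)%N = (#|orbit to G @: [set: T]| * #|G|)%N.
Proof.
rewrite -Frobenius_Cauchy; last by apply/actsP => a _ x; rewrite !inE.
by apply: eq_bigr => a _; rewrite finset.setTI.
Qed.

Section UniformProbability.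
Variables (R : realType) (gT : finGroupType) (P : {group gT}).

Lemma unif_prob_le1 (E : pred gT) : unif_prob R P E <= 1.
Proof.
rewrite /unif_prob ler_pdivrMr ?ltr0n ?cardG_gt0 // mul1r ler_nat.
by apply/subset_leq_card/fintype.subsetP => s; rewrite !inE => /andP[].
Qed.

(** Markov's inequality for the complement of [E], where [f] is at least [c]. Leaving [f] general
    lets squared deviations be used as well. *)
Lemma markov_unif_prob (E : pred gT) (f : gT -> R) (c : R) :
  0 < c -> (forall s, s \in P -> 0 <= f s) ->
  (forall s, s \in P -> ~~ E s -> c <= f s) ->
  1 - (\sum_(s in P) f s) / #|P|%:R / c <= unif_prob R P E.
Proof.
move=> c0 f0 fc; have P0 : 0 < #|P|%:R :> R by rewrite ltr0n cardG_gt0.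
rewrite lerBlDr -lerBlDl ler_pdivlMr // ler_pdivlMr //.
have -> : (1 - unif_prob R P E) * c * #|P|%:R
          = c * (#|P|%:R - #|[set s in P | E s]|%:R).
  by rewrite /unif_prob; field; rewrite gt_eqF.
rewrite -!sum1_card !natr_sum (bigID E) /=.
rewrite [X in _ - X](eq_bigl (fun s => (s \in P) && E s)); last first.
  by move=> s; rewrite inE.
(* The terms in [E] cancel, leaving [c] summed over the elements of [P] outside [E]. On the right,
   the [E] part of the sum of [f] is dropped as nonnegative. *)
rewrite addrAC subrr add0r mulr_sumr [leRHS](bigID E) /=.
rewrite -[leLHS]add0r lerD ?sumr_ge0 // => [s /andP[/f0]//|].
by apply: ler_sum => s /andP[sP sE]; rewrite mulr1 fc.
Qed.

End UniformProbability.

Section PermutationGroup.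
Variables (R : realType) (n : nat) (P : {group 'S_n}).
Let f (s : 'S_n) : R := #|('Fix_'P[s])%g|%:R.
Let t : R := (num_orbits P)%:R.

Let P_neq0 : #|P|%:R != 0 :> R.
Proof. by rewrite pnatr_eq0 -lt0n cardG_gt0. Qed.

Lemma mean_fix : (\sum_(s in P) f s) / #|P|%:R = t.
Proof. by rewrite -natr_sum sum_fix natrM mulfK. Qed.

Lemma variance_fix :
  (\sum_(s in P) (f s - t) ^+ 2) / #|P|%:R = (perm_rank P)%:R - t ^+ 2.
Proof.
have E1 : \sum_(s in P) f s = t * #|P|%:R by rewrite -mean_fix divfK.
have E2 : \sum_(s in P) f s ^+ 2 = (perm_rank P)%:R * #|P|%:R.
  under eq_bigr do rewrite -natrX -card_fix_pairs.
  by rewrite -natr_sum sum_fix natrM.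
under eq_bigr do rewrite sqrrB.
(* With r the rank, the three sums are [#|P|] times r, 2 t^2 and t^2. *)
rewrite big_split sumrB /= sumr_const E2 sumrMnl -mulr_suml E1.
by rewrite -(mulr_natr _ #|P|) -(mulr_natr _ 2); field.
Qed.

Lemma psuppE (s : 'S_n) : (psupp s)%:R = n%:R - f s :> R.
Proof. by apply/eqP; rewrite eq_sym subr_eq -natrD psupp_fix. Qed.

Lemma unif_prob_psupp_mean (eps : R) : (0 < n)%N -> 0 < eps ->
  1 - t / (eps * n%:R)
    <= unif_prob R P (fun s => (1 - eps) * n%:R < (psupp s)%:R).
Proof.
move=> n0 e0; rewrite -mean_fix; apply: markov_unif_prob => [|//|s _].
  by rewrite mulr_gt0 ?ltr0n.
by rewrite -leNgt psuppE => h; lra.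
Qed.

Lemma unif_prob_psupp_variance (eps : R) : (0 < n)%N -> 0 < eps ->
  1 - ((perm_rank P)%:R - t ^+ 2) / (eps ^+ 2 * n%:R ^+ 2)
    <= unif_prob R P (fun s => (1 - eps) * n%:R - t < (psupp s)%:R).
Proof.
move=> n0 e0; rewrite -variance_fix.
have en0 : 0 < eps * n%:R by rewrite mulr_gt0 ?ltr0n.
rewrite -exprMn; apply: markov_unif_prob => [|s _|s _].
- exact: exprn_gt0.
- exact: sqr_ge0.
(* When the event fails, [f s - t] is at least [eps * n%:R], which is positive, so squaring
   preserves the inequality. *)
- by rewrite -leNgt psuppE => h; rewrite ler_sqr ?nnegrE; lra.
Qed.

End PermutationGroup.

Local Open Scope classical_set_scope.

(** A squeeze: [1 - u k] lies between 0 and [a k / (c * b k)], which tends to 0. *)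
Lemma cvg_to1_littleo (R : realType) (c : R) (u a b : nat -> R) :
  0 < c -> (forall k, 0 < b k) -> (forall k, u k <= 1) ->
  (forall k, 1 - a k / (c * b k) <= u k) ->
  (a : nat -> R^o) =o_\oo (b : nat -> R^o) ->
  u k @[k --> \oo] --> (1 : R).
Proof.
move=> c0 b0 u1 ua /eqoP ab; apply/cvgrPdist_le => e e0.
(* The factor [c] in the little-o constant absorbs the one in the denominator. *)
have := ab (e * c) (mulr_gt0 e0 c0); apply: filterS => k /= abk.
rewrite ger0_norm ?subr_ge0 // lerBlDl -lerBlDr; apply: le_trans (ua k).
rewrite lerB // ler_pdivrMr ?mulr_gt0 // mulrA.
by apply: le_trans (ler_norm _) (le_trans abk _); rewrite gtr0_norm.
Qed.

Theorem proposition3p3 (R : realType) :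
  (* (1) *)
  ((forall (n : nat) (P : {group 'S_n}) (eps : R),
      (0 < n)%N -> 0 < eps -> eps < 1 ->
      1 - (num_orbits P)%:R / (eps * n%:R)
        <= unif_prob R P (fun s => (1 - eps) * n%:R < (psupp s)%:R))
   /\
   (forall (eps : R) (n : nat -> nat) (P : forall k : nat, {group 'S_(n k)}),
      0 < eps -> eps < 1 -> (forall k : nat, (0 < n k)%N) ->
      (fun k : nat => (num_orbits (P k))%:R : R^o)
        =o_\oo (fun k : nat => (n k)%:R : R^o) ->
      unif_prob R (P k)
        (fun s => (1 - eps) * (n k)%:R < (psupp s)%:R) @[k --> \oo] --> (1 : R)))
  /\
  (* (2) *)
  ((forall (n : nat) (P : {group 'S_n}) (eps : R),
      (0 < n)%N -> 0 < eps -> eps < 1 ->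
      1 - ((perm_rank P)%:R - (num_orbits P)%:R ^+ 2) / (eps ^+ 2 * n%:R ^+ 2)
        <= unif_prob R P
             (fun s => (1 - eps) * n%:R - (num_orbits P)%:R < (psupp s)%:R))
   /\
   (forall (eps : R) (n : nat -> nat) (P : forall k : nat, {group 'S_(n k)}),
      0 < eps -> eps < 1 -> (forall k : nat, (0 < n k)%N) ->
      (fun k : nat =>
         (perm_rank (P k))%:R - (num_orbits (P k))%:R ^+ 2 : R^o)
        =o_\oo (fun k : nat => (n k)%:R ^+ 2 : R^o) ->
      unif_prob R (P k)
        (fun s => (1 - eps) * (n k)%:R - (num_orbits (P k))%:R < (psupp s)%:R)
        @[k --> \oo] --> (1 : R))).
Proof.
split; split=> [n P eps n0 e0 _|eps n P e0 _ n0].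
- exact: unif_prob_psupp_mean.
- apply: (cvg_to1_littleo e0) => k; rewrite ?ltr0n ?n0 ?unif_prob_le1 //.
  exact: unif_prob_psupp_mean.
- exact: unif_prob_psupp_variance.
(* Here [c] is [eps ^+ 2] and [b] is the square of the degree, as in Chebyshev's bound. *)
- apply: (cvg_to1_littleo (exprn_gt0 2 e0)) => k.
  + by rewrite exprn_gt0 // ltr0n.
  + exact: unif_prob_le1.
  + exact: unif_prob_psupp_variance.
Qed.
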